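(* Let $X$ be any infinite locally compact Hausdorff space. Then $m(C_0(X))\ge\omega$.
   Context: $C_0(X)$ is the Banach space, with the supremum norm, of all continuous functions $f:X\to\mathbb{R}$ such that for every $\varepsilon>0$ there is a compact $K\subseteq X$ with $|f(x)|<\varepsilon$ for all $x\in X\setminus K$. A subset $S$ of a metric space $(M,d)$ is equilateral if there is $\lambda>0$ with $d(x,y)=\lambda$ for all distinct $x,y\in S$. An equilateral set $A\subseteq M$ is maximal if there is no equilateral set $B\subseteq M$ with $A\subsetneq B$. $m(M)=\min\{|A|: A \text{ is a maximal equilateral set in } M\}$ (a cardinal). A normed space is regarded as a metric space via its norm. *)

(* Defs.v *)
From HB Require Import structures.
From mathcomp Require Import all_boot all_order all_algebra.
From mathcomp Require Import all_classical all_reals all_analysis.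
From mathcomp Require Import lra.
Set Implicit Arguments.
Unset Strict Implicit.
Unset Printing Implicit Defensive.
Import Order.TTheory GRing.Theory Num.Theory.
Import numFieldNormedType.Exports.
Local Open Scope classical_set_scope.
Local Open Scope ring_scope.
Local Open Scope card_scope.

Section equilateral.
Context {R : realType} {M : metricType R}.
Implicit Types A B S : set M.

Definition equilateral S :=
  exists2 lambda : R, 0 < lambda &
    forall x y, S x -> S y -> x <> y -> mdist x y = lambda.

Definition maximal_equilateral A :=
  equilateral A /\ ~ (exists B, equilateral B /\ A `<` B).

Lemma maximal_equilateral_ex : exists A : set M, maximal_equilateral A.
Proof.
have [F FE Ftot|A [eA Amax]] := @Zorn_bigcup M equilateral; last first.
  by exists A; split=> // -[B [eB /Amax]].
have [[x [y [xF yF xy]]]|H] := pselect (exists x y,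
  [/\ (\bigcup_(S in F) S) x, (\bigcup_(S in F) S) y & x <> y]); last first.
  exists 1 => // x y xF yF xy; exfalso; apply: H; by exists x, y.
exists (mdist x y); first by rewrite mdist_gt0; exact/eqP.
have join U V : F U -> F V -> exists W, [/\ F W, U `<=` W & V `<=` W].
  move=> FU FV; have [UV|VU] := Ftot _ _ FU FV.
    by exists V; split=> // t; exact: UV.
  by exists U; split=> // t; exact: VU.
move=> u v [U FU Uu] [V FV Vv] uv.
have [[P FP Px] [Q FQ Qy]] := (xF, yF).
have [W1 [FW1 UW VW]] := join _ _ FU FV.
have [W2 [FW2 PW QW]] := join _ _ FP FQ.
have [W [FW W1W W2W]] := join _ _ FW1 FW2.
have [l _ lW] := FE _ FW.
rewrite (lW u v) ?(lW x y)//.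
- exact/W2W/PW.
- exact/W2W/QW.
- exact/W1W/UW.
- exact/W1W/VW.
Qed.

End equilateral.

Definition least_card {T : Type} (F : set (set T)) (A : set T) :=
  F A /\ forall B, F B -> A #<= B.

Lemma least_card_ex {T : Type} (F : set (set T)) :
  F !=set0 -> exists A, least_card F A.
Proof.
move=> [F0 FF0].
pose P (G : set (set T -> T)) :=
  (forall g, G g -> forall A, F A -> A (g A)) /\
  (forall g h, G g -> G h -> forall A, F A -> g A = h A -> g = h).
have [C CP Ctot|G [[Gsel Ginj] Gmax]] := @Zorn_bigcup _ P.
  split=> [g [G CG Gg]|g h [G CG Gg] [H CH Hh]].
    exact: (CP _ CG).1.
  have [GH|HG] := Ctot _ _ CG CH.
    by apply: (CP _ CH).2 => //; exact: GH.
  by apply: (CP _ CG).2 => //; exact: HG.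
have [A FA Ahit] : exists2 A, F A &
    forall a, A a -> exists2 g, G g & g A = a.
  apply: contrapT => H.
  have miss A : exists a, F A -> A a /\ forall g, G g -> g A <> a.
    have [FA|NFA] := pselect (F A); last first.
      have [[a _]|NA] := pselect (A !=set0); first by exists a.
      have [[a _]|NF0] := pselect (F0 !=set0); first by exists a.
      exfalso; apply: H; exists F0 => // a F0a.
      by exfalso; apply: NF0; exists a.
    apply: contrapT => HA; apply: H; exists A => // a Aa.
    apply: contrapT => Ha; apply: HA; exists a => _; split=> // g Gg gA.
    by apply: Ha; exists g.
  have [g0 g0P] := choice miss.
  have Ng0 : ~ G g0 by move=> /(g0P F0 FF0).2; exact.
  apply: (Gmax (G `|` [set g0])).
    split; first by move=> g Gg; left.
    by move=> /(_ g0 (or_intror erefl)).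
  split=> [g [/Gsel//|-> A /g0P[]//]|g h [Gg|->] [Gh|->] A FA gh //].
  - exact: Ginj gh.
  - by have := (g0P A FA).2 _ Gg.
  - by have := (g0P A FA).2 _ Gh; rewrite -gh.
exists A; split=> // B FB.
have hit a : exists g, A a -> G g /\ g A = a.
  have [Aa|NAa] := pselect (A a); last by exists (fun=> a).
  by have [g Gg gA] := Ahit _ Aa; exists g.
have [s sP] := choice hit.
suff [f] : $|{injfun A >-> B}| by exact: (inj_card_le f).
apply/injfunPex; exists (fun a => s a B).
  by move=> a /sP[Gs _]; exact: (Gsel _ Gs _ FB).
move=> a b /set_mem Aa /set_mem Ab sab.
have [[Ga <-] [Gb <-]] := (sP _ Aa, sP _ Ab).
by rewrite (Ginj _ _ Ga Gb _ FB sab).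
Qed.

(* The minimum of |A| over the maximal equilateral sets A of M.  As there is no
   type of cardinals, this cardinal is represented by a set realizing it, to be
   compared only through #<= and #=.  The minimum is always attained
   ([m_equilateralP]), so the default value [set0] plays no role. *)
Definition m_equilateral {R : realType} (M : metricType R) : set M :=
  xget set0 (least_card (@maximal_equilateral R M)).
Arguments m_equilateral {R} M.

Lemma m_equilateralP {R : realType} (M : metricType R) :
  least_card (@maximal_equilateral R M) (m_equilateral M).
Proof.
apply: xgetPex; apply: least_card_ex; exact: maximal_equilateral_ex.
Qed.

Section C0.
Context {R : realType} {X : topologicalType}.
Implicit Types f g : X -> R.

Definition vanishes_at_infinity f :=
  forall eps : R, 0 < eps ->
    exists2 K : set X, compact K & forall x, (~` K) x -> `|f x| < eps.

Definition C0_pred : {pred X -> R} :=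
  fun f => `[< continuous f /\ vanishes_at_infinity f >].

Lemma C0_predP f :
  reflect (continuous f /\ vanishes_at_infinity f) (f \in C0_pred).
Proof. exact: asboolP. Qed.

Fact C0_pred_submod : submod_closed C0_pred.
Proof.
split.
  apply/C0_predP; split; first by move=> x; exact: cvg_cst.
  by move=> e e0; exists set0 => [|x _]; [exact: compact0 | rewrite normr0].
move=> a f g /C0_predP[cf vf] /C0_predP[cg vg]; apply/C0_predP; split.
  by move=> x; apply: cvgD; [apply: cvgZl_tmp; exact: cf | exact: cg].
move=> e e0.
have a1 : 0 < `|a| + 1 by rewrite ltr_wpDl.
have [K cK Kf] := vf (e / 2 / (`|a| + 1)) ltac:(by rewrite !divr_gt0).
have [L cL Lg] := vg (e / 2) ltac:(by rewrite divr_gt0).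
exists (K `|` L); first exact: compactU.
move=> x /not_orP[/Kf fx /Lg gx]; rewrite (le_lt_trans (ler_normD _ _))//.
rewrite [e]splitr ler_ltD// normrM.
rewrite (le_trans (ler_wpM2l (normr_ge0 a) (ltW fx)))//.
rewrite mulrA ler_pdivrMr// mulrC ler_wpM2l ?divr_ge0 ?(ltW e0)//.
by rewrite lerDl.
Qed.

HB.instance Definition _ :=
  GRing.isSubmodClosed.Build R (X -> R) C0_pred C0_pred_submod.

End C0.

Record C0 (R : realType) (X : topologicalType) :=
  MkC0 { C0_fun :> X -> R ; C0_funP : C0_fun \in C0_pred }.

Section C0_normed.
Context {R : realType} {X : topologicalType}.
Local Notation C0 := (C0 R X).
Implicit Types f g : C0.

HB.instance Definition _ := [isSub for @C0_fun R X].
HB.instance Definition _ := [Choice of C0 by <:].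
HB.instance Definition _ := [SubChoice_isSubLmodule of C0 by <:].

Lemma C0_continuous f : continuous f.
Proof. by have /C0_predP[] := C0_funP f. Qed.

Lemma C0_vanishes f : vanishes_at_infinity f.
Proof. by have /C0_predP[] := C0_funP f. Qed.

Definition C0_norm f : R := sup (range (fun x => `|f x|)).

Lemma C0_has_ubound f : has_ubound (range (fun x => `|f x|)).
Proof.
have [K cK Kf] := C0_vanishes f ltr01.
have := @continuous_compact _ _ f K (continuous_subspaceT (@C0_continuous f)) cK.
move=> /compact_bounded[N [_ NK]].
exists (Num.max 1 (N + 1)) => _ [x _ <-]; rewrite le_max.
have [Kx|/Kf/ltW->//] := pselect (K x).
by apply/orP; right; apply: (NK (N + 1)); [rewrite ltrDl | exists x].
Qed.

Lemma C0_norm_ub f x : `|f x| <= C0_norm f.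
Proof. by apply: ub_le_sup; [exact: C0_has_ubound | exists x]. Qed.

Lemma C0_norm_ge0 f : 0 <= C0_norm f.
Proof.
have [[x _]|/nonemptyPn X0] := pselect ([set: X] !=set0).
  exact: le_trans (C0_norm_ub f x).
by rewrite /C0_norm X0 image_set0 sup0.
Qed.

Lemma C0_norm_le f (r : R) : 0 <= r -> (forall x, `|f x| <= r) -> C0_norm f <= r.
Proof.
move=> r0 fr; have [[x _]|/nonemptyPn X0] := pselect ([set: X] !=set0).
  by apply: ge_sup; [exists `|f x|, x | move=> _ [y _ <-]].
by rewrite /C0_norm X0 image_set0 sup0.
Qed.

Let C0_normD f g : C0_norm (f + g) <= C0_norm f + C0_norm g.
Proof.
apply: C0_norm_le => [|x]; first by rewrite addr_ge0 ?C0_norm_ge0.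
by rewrite (le_trans (ler_normD _ _))// lerD ?C0_norm_ub.
Qed.

Let C0_normZ (a : R) f : C0_norm (a *: f) = `|a| * C0_norm f.
Proof.
have le (b : R) (h : C0) : C0_norm (b *: h) <= `|b| * C0_norm h.
  apply: C0_norm_le => [|x]; first by rewrite mulr_ge0 ?C0_norm_ge0.
  by rewrite normrM ler_wpM2l ?C0_norm_ub.
apply/eqP; rewrite eq_le le/=; have [->|a0] := eqVneq a 0.
  by rewrite normr0 mul0r C0_norm_ge0.
rewrite -ler_pdivlMl ?normr_gt0// -normfV.
by rewrite -{1}(scale1r f) -(mulVf a0) -scalerA le.
Qed.

Let C0_norm0_eq0 f : C0_norm f = 0 -> f = 0.
Proof.
move=> f0; apply/val_inj/funext => x; apply/eqP.
by rewrite -normr_le0 -f0 C0_norm_ub.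
Qed.

HB.instance Definition _ :=
  Lmodule_isNormed.Build R C0 C0_normD C0_normZ C0_norm0_eq0.

Lemma C0_normE f : `|f| = sup (range (fun x => `|f x|)).
Proof. by []. Qed.

Let C0_complete (F : set_system C0) : ProperFilter F -> cauchy F -> cvg F.
Proof.
move=> FF /cauchyP Fc.
have {}Fc (e : R) : 0 < e -> exists f, F [set g | forall x, `|f x - g x| < e].
  move=> e0; have [f Ff] := Fc e e0; exists f.
  apply: filterS Ff => g; rewrite -ball_normE/= => fg x.
  exact: le_lt_trans (C0_norm_ub (f - g) x) fg.
have Fx x : cvg ((fun f : C0 => f x : R) @ F).
  apply/cauchy_cvgP/cauchyP => e e0.
  have [f Ff] := Fc e e0; exists (f x).
  by rewrite /fmap/=; apply: filterS Ff => g; exact.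
pose l x : R := lim ((fun f : C0 => f x : R) @ F).
have Fl (e : R) : 0 < e -> exists f : C0,
    F [set g | forall x, `|f x - g x| < e] /\ forall x, `|f x - l x| <= e.
  move=> e0; have [f Ff] := Fc e e0; exists f; split=> // x.
  have cfl : `|f x - g x| @[g --> F] --> `|f x - l x|.
    by apply: cvg_norm; apply: cvgB; [exact: cvg_cst | exact: Fx].
  rewrite -(cvg_lim (@Rhausdorff R) cfl).
  apply: limr_le; first by apply/cvg_ex; exists `|f x - l x|.
  by apply: filterS Ff => g /(_ x)/ltW.
have lC0 : l \in C0_pred.
  apply/C0_predP; split.
    move=> x; apply/cvgrPdist_lt => e e0.
    have e3 : 0 < e / 3 by rewrite divr_gt0.
    have [f [_ fl]] := Fl _ e3.
    have /cvgrPdist_lt/(_ _ e3) := @C0_continuous f x.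
    apply: filterS => y fxy.
    have := fl x; have := fl y; move: fxy.
    by rewrite !(ltr_norml, ler_norml) => /andP[? ?] /andP[? ?] /andP[? ?]; lra.
  move=> e e0; have e2 : 0 < e / 2 by rewrite divr_gt0.
  have [f [_ fl]] := Fl _ e2.
  have [K cK Kf] := C0_vanishes f e2.
  exists K => // x /Kf; have := fl x.
  by rewrite !(ltr_norml, ler_norml) => /andP[? ?] /andP[? ?]; lra.
apply/cvg_ex; exists (MkC0 lC0); apply/cvgrPdist_lt => e e0.
have e3 : 0 < e / 3 by rewrite divr_gt0.
have [f [Ff fl]] := Fl _ e3.
apply: filterS Ff => g fg.
apply: (@le_lt_trans _ _ (2 * (e / 3))); last by lra.
apply: C0_norm_le => [|x]; first by lra.
rewrite [X in `|X|](_ : _ = l x - g x)//.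
have := fl x; have := fg x.
by rewrite !(ltr_norml, ler_norml) => /andP[? ?] /andP[? ?]; lra.
Qed.

HB.instance Definition _ := Uniform_isComplete.Build C0 C0_complete.

Let dist f g : R := `|f - g|.

Let dist_ge0 f g : 0 <= dist f g.
Proof. exact: normr_ge0. Qed.

Let dist_eq0 f g : dist f g = 0 -> f = g.
Proof. by move/normr0_eq0/eqP; rewrite subr_eq0 => /eqP. Qed.

Let ball_dist f d : ball f d = [set g | dist f g < d].
Proof. by rewrite -ball_normE. Qed.

HB.instance Definition _ :=
  PseudoMetric_isMetric.Build R C0 dist_ge0 dist_eq0 ball_dist.

Lemma C0_mdistE f g : mdist f g = `|f - g|.
Proof. by []. Qed.

End C0_normed.

(* Main.v *)
(* Let A be a finite equilateral set of distance l.  Every difference of two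
   members attains its norm; let P be a finite set of points containing one such
   point for each pair, and choose x0 outside P (X is infinite).  Let M be the
   pointwise maximum of A, let j in A satisfy j x0 = M x0, and let phi >= 0 in
   C0 be 1 at x0 and 0 on P.  Then g = max (j - l phi, M - l) extends A:
   M - l <= g <= j gives |g - f| <= l for all f in A; equality is attained at x0
   for f = j, and for f <> j at the point of P chosen for (j, f), where g = j. *)
Require Import Defs.
From mathcomp Require Import all_boot all_order all_algebra.
From mathcomp Require Import all_classical all_reals all_analysis.
From mathcomp Require Import lra.
Import Order.TTheory GRing.Theory Num.Theory.
Import numFieldNormedType.Exports.
Local Open Scope classical_set_scope.
Local Open Scope card_scope.

Section separation.
Local Open Scope ring_scope.

Lemma closed_finite_set {T : topologicalType} (P : set T) :
  hausdorff_space T -> finite_set P -> closed P.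
Proof. by move=> /hausdorff_accessible/accessible_finite_set_closed; apply. Qed.

(** Complete regularity gives [u] with value 0 at [x0] and 1 on [B], the union of [P] and the
    complement of the interior of a compact neighbourhood [U] of [x0]. Then [1 - u] vanishes outside
    [U], hence lies in [C0]. *)
Lemma C0_bump {R : realType} {X : topologicalType} (P : set X) (x0 : X) :
  locally_compact [set: X] -> hausdorff_space X -> closed P -> ~ P x0 ->
  exists phi : C0 R X, [/\ forall x, 0 <= phi x, phi x0 = 1 &
    forall x, P x -> phi x = 0].
Proof.
move=> lcX hX cP Px0.
have [U] := lcX x0 I.
rewrite withinET => nU [cU clU].
pose B : set X := ~` U° `|` P.
have clB : closed B.
  by apply: closedU => //; apply: open_closedC; exact: open_interior.
have Bx0 : ~ B x0 by move=> [].
have /(@uniform_separatorP X R)[u [uc u01 u0 u1]] :=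
  @locally_compact_completely_regular X R lcX hX x0 B clB Bx0.
have phiC0 : (fun x => 1 - u x) \in C0_pred.
  apply/C0_predP; split.
    by move=> x; apply: cvgB; [exact: cvg_cst|exact: uc].
  move=> e e0; exists U => // x Ux.
  suff -> : u x = 1 by rewrite subrr normr0.
  by apply: u1; exists x => //; left => /interior_subset.
exists (MkC0 phiC0); split=> /=.
- move=> x; have : `[0, 1]%classic (u x) by apply: u01; exists x.
  by rewrite /= in_itv/= subr_ge0 => /andP[].
- suff -> : u x0 = 0 by rewrite subr0.
  by apply: u0; exists x0.
- move=> x Px; suff -> : u x = 1 by rewrite subrr.
  by apply: u1; exists x => //; right.
Qed.

End separation.

Section C0_extra.
Local Open Scope ring_scope.
Context {R : realType} {X : topologicalType}.
Implicit Types f g h : C0 R X.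

(** Outside a compact [K] the values stay below half the norm, so the supremum is the maximum over
    [K]. *)
Lemma C0_normP h : 0 < `|h| -> exists x, `|h x| = `|h|.
Proof.
move=> h0; have h20 : 0 < `|h| / 2 by rewrite divr_gt0.
have [K cK Kh] := C0_vanishes h h20.
have [[y Ky]|/nonemptyPn K0] := pselect (K !=set0); last first.
  have : `|h| <= `|h| / 2.
    by apply: C0_norm_le (ltW h20) _ => x; apply/ltW/Kh; rewrite K0.
  by lra.
have hc : {within K, continuous (fun x => `|h x|)}.
  apply: continuous_subspaceT => x.
  by apply: cvg_norm; exact: C0_continuous.
have [c _ hcmax] := compact_EVT_max (ex_intro _ y Ky) cK hc.
exists c; apply/eqP; rewrite eq_le C0_norm_ub/=.
have : `|h| <= Num.max (`|h c|) (`|h| / 2).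
  apply: C0_norm_le => [|x]; first by rewrite le_max normr_ge0.
  rewrite le_max; have [Kx|/Kh/ltW->] := pselect (K x); last by rewrite orbT.
  by rewrite hcmax ?inE.
by rewrite le_max => /orP[//|]; lra.
Qed.

Lemma pointwise_max (A : set (C0 R X)) : finite_set A -> A !=set0 ->
  exists M : X -> R, [/\ continuous M, forall f x, A f -> f x <= M x &
    forall x, exists2 f, A f & f x = M x].
Proof.
move=> /finite_seqP[s ->]; case: s => [[? //]|f s _].
elim: s f => [|g s IHs] f.
  exists f; split; first exact: C0_continuous.
  - by move=> g x /=; rewrite inE => /eqP->.
  - by move=> x; exists f => //=; rewrite inE.
have [M [Mc Mub Mex]] := IHs g.
exists (fun x => Num.max (f x) (M x)); split.
- by move=> x; apply: continuous_max; [exact: C0_continuous|exact: Mc].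
- move=> h x /=; rewrite inE le_max => /orP[/eqP->|hs]; first by rewrite lexx.
  by rewrite (Mub h x hs) orbT.
- move=> x; have [fM|Mf] := leP (f x) (M x).
    by have [h hs <-] := Mex x; exists h => //=; rewrite inE hs orbT.
  by exists f => //=; rewrite inE eqxx.
Qed.

Lemma finite_equilateral_extend (A : set (C0 R X)) (l : R) :
  infinite_set [set: X] -> locally_compact [set: X] -> hausdorff_space X ->
  finite_set A -> A !=set0 -> 0 < l ->
  (forall f g, A f -> A g -> f <> g -> `|f - g| = l) ->
  exists g, forall f, A f -> `|g - f| = l.
Proof.
move=> Xinf lcX hX finA A0 l0 Al.
(* For a pair with zero difference, [p] takes an arbitrary point of [X]. *)
have /choice[p pP] : forall fg : C0 R X * C0 R X, exists x, 0 < `|fg.1 - fg.2| ->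
    `|(fg.1 - fg.2) x| = `|fg.1 - fg.2|.
  move=> fg; have [/C0_normP[x xE]|] := ltP 0 `|fg.1 - fg.2|; first by exists x.
  by have [x _] := infinite_setN0 Xinf; exists x.
pose P := p @` (A `*` A).
have finP : finite_set P by apply: finite_image; exact: finite_setX.
have [x0 Px0] : exists x0, ~ P x0.
  apply: contrapT => /forallNP allP; apply: Xinf.
  by apply: sub_finite_set finP => x _; apply: contrapT; exact: allP.
have [M [Mc Mub Mex]] := pointwise_max A finA A0.
have [j Aj jM] := Mex x0.
have [phi [phi0 phix0 phiP]] :=
  @C0_bump R X P x0 lcX hX (closed_finite_set P hX finP) Px0.
have Adist f g x : A f -> A g -> `|f x - g x| <= l.
  move=> Af Ag; have [->|/eqP fg] := eqVneq f g.
    by rewrite subrr normr0 ltW.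
  by rewrite -(Al _ _ Af Ag fg); exact: (C0_norm_ub (f - g) x).
(* [M x] is the value at [x] of some member of [A], and members differ by at most [l] there. *)
have Ml x : M x - l <= j x.
  by have [f Af <-] := Mex x; have := Adist f j x Af Aj; rewrite ler_norml => /andP[? ?]; lra.
pose g x := Num.max (j x - l * phi x) (M x - l).
have gj x : g x <= j x.
  by rewrite ge_max Ml andbT gerBl mulr_ge0// ltW.
have gphi x : j x - l * phi x <= g x by rewrite le_max lexx.
have gM x : M x - l <= g x by rewrite le_max lexx orbT.
have gC0 : g \in C0_pred.
  apply/C0_predP; split.
    move=> x; apply: (@continuous_max _ _ (fun y => j y - l * phi y)
      (fun y => M y - l)).
      apply: cvgB; first exact: C0_continuous.
      by apply: cvgM; [exact: cvg_cst|exact: C0_continuous].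
    by apply: cvgB; [exact: Mc|exact: cvg_cst].
  (* [M - l] need not vanish at infinity, but [g] is squeezed between [j - l *: phi] and [j], which
     do. *)
  move=> e e0; have [K cK Kj] := C0_vanishes j e0.
  have [L cL Lh] := C0_vanishes (j - l *: phi) e0.
  exists (K `|` L); first exact: compactU.
  move=> x /not_orP[/Kj jx /Lh]; rewrite [X in `|X|](_ : _ = j x - l * phi x)//.
  move: jx (gj x) (gphi x).
  by rewrite !ltr_norml => /andP[? ?] ? ? /andP[? ?]; lra.
exists (MkC0 gC0) => f Af; apply/eqP; rewrite eq_le; apply/andP; split.
  (* Above, [g - f <= j - f <= l]; below, [g - f >= M - l - f >= - l]. *)
  apply: C0_norm_le => [|x]; first exact: ltW.
  rewrite [X in `|X|](_ : _ = g x - f x)//.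
  move: (Adist j f x Aj Af) (gj x) (gM x) (Mub f x Af).
  by rewrite !ler_norml => /andP[? ?]; lra.
(* At [x0] both arguments of the maximum equal [j x0 - l]. *)
have [->|/eqP fj] := eqVneq f j.
  apply: le_trans (C0_norm_ub (MkC0 gC0 - j) x0).
  rewrite [X in `|X|](_ : _ = g x0 - j x0)//.
  by rewrite /g jM phix0 mulr1 maxxx addrAC subrr add0r normrN gtr0_norm.
have jfl : `|j - f| = l by apply: Al => // jf; exact: fj.
have := pP (j, f); rewrite /= jfl => /(_ l0) jfp.
apply: le_trans (C0_norm_ub (MkC0 gC0 - f) (p (j, f))).
rewrite -[leLHS]jfp [leLHS](_ : _ = `|j (p (j, f)) - f (p (j, f))|)//.
rewrite [leRHS](_ : _ = `|g (p (j, f)) - f (p (j, f))|)//.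
(* As [phi] vanishes on [P], the lower bound [j - l * phi] of [g] meets its upper bound [j] here. *)
suff -> : g (p (j, f)) = j (p (j, f)) by [].
have := gphi (p (j, f)); rewrite phiP ?mulr0 ?subr0; last by exists (j, f).
by move=> jg; apply/eqP; rewrite eq_le gj.
Qed.

End C0_extra.

Theorem theorem3 (R : realType) (X : topologicalType)
  (X_infinite : infinite_set [set: X])
  (X_locally_compact : locally_compact [set: X])
  (X_hausdorff : hausdorff_space X) :
  [set: nat] #<= m_equilateral (C0 R X).
Proof.
apply/infiniteP => finA.
have [[[l l0 Al] Amax] _] := m_equilateralP (C0 R X).
set A := m_equilateral _ in finA Al Amax.
(* The empty set is not maximal: a singleton is vacuously equilateral, for instance with distance
   1. *)
have [A0|/nonemptyPn A0] := pselect (A !=set0); last first.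
  apply: Amax; exists [set 0%R]; split.
    by exists 1%R => // f g -> ->.
  by rewrite A0; split=> [//|/(_ 0%R erefl)].
have [g gA] := @finite_equilateral_extend R X A l
  X_infinite X_locally_compact X_hausdorff finA A0 l0 Al.
apply: Amax; exists (g |` A); split.
  exists l => // f h [->|Af] [->|Ah] // fh.
  - by rewrite C0_mdistE gA.
  - by rewrite C0_mdistE distrC gA.
  - exact: Al.
(* The extension is proper: [g] in [A] would give [l = |g - g| = 0]. *)
split=> [|/(_ g (or_introl erefl)) Ag]; first by right.
by have := gA g Ag; rewrite subrr normr0 => l0'; rewrite -l0' ltxx in l0.
Qed.
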